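(* Let $n,m\ge 1$ be integers and let $1^{k_1} i_2^{k_2}\cdots i_r^{k_r}$ be a type with $r\ge 2$, $1<i_2<\cdots<i_r$, all $k_j\ge 1$, and $n=k_1+\sum_{j=2}^r k_j i_j$, satisfying \[ \left\lceil\frac{k_1}{k_2+\cdots+k_r}\right\rceil\ge (m-1)(i_r-1). \] Then the number of $m$-AP-partitions of $\mathbb{Z}_n$ of this type does not depend on $m$ and equals \[ \frac{n}{k_1+\cdots+k_r}\binom{k_1+\cdots+k_r}{k_1,\ldots,k_r}. \]
   Context: $\mathbb{Z}_n$ is the cyclic group of order $n$ with elements written $1,2,\ldots,n$, viewed as a directed cycle. An $m$-AP-block of length $i$ is a sequence $(x, x+m, x+2m,\ldots,x+(i-1)m) \pmod n$ of $i$ distinct elements of $\mathbb{Z}_n$ (sequences, so blocks differing only in order are distinct); $x$ is its head. An $m$-AP-partition of $\mathbb{Z}_n$ is a set of $m$-AP-blocks whose underlying sets form a partition of $\mathbb{Z}_n$; its type is $1^{k_1}i_2^{k_2}\cdots i_r^{k_r}$ if it has $k_1$ blocks of length $1$ and $k_j$ blocks of length $i_j$ for $2\le j\le r$. $\lceil x\rceil$ is the least integer $\ge x$. *)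

(* Defs.v *)
From mathcomp Require Import all_boot all_order all_algebra.

Set Implicit Arguments.
Unset Strict Implicit.
Unset Printing Implicit Defensive.

Import GRing.Theory Num.Theory.

(* The cyclic group of order n is carried by 'I_n with arithmetic modulo n, the
   residue n being represented by 0.  'Z_n is avoided because 'Z_1 is not of
   order 1. *)

(* Blocks are sequences, so two orderings of the same elements are distinct
   blocks.  The clause 0 < size s reflects that a block has a head. *)
Definition AP_block (n m : nat) (s : seq 'I_n) : bool :=
  [&& 0 < size s, uniq s &
      [exists x : 'I_n,
        [seq val y | y <- s] ==
          mkseq (fun j => (x + j * m) %% n) (size s)]].

Definition underlying (n : nat) (s : n.-bseq 'I_n) : {set 'I_n} :=
  [set x in s].

(* A sequence of distinct elements of 'I_n has length at most n, so ranging
   over the finite type n.-bseq 'I_n excludes no block.  Injectivity is needed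
   as the underlying sets must partition 'I_n as a family indexed by P: two
   different blocks of P may not cover the same set. *)
Definition AP_partition (n m : nat) (P : {set n.-bseq 'I_n}) : bool :=
  [&& [forall s in P, AP_block m s],
      dinjectiveb (@underlying n) (mem P) &
      partition [set underlying s | s in P] [set: 'I_n]].

(* The type 1^(k 1) (i 2)^(k 2) ... (i r)^(k r), under the convention i 1 = 1.
   Values of i and k outside the indices 1, ..., r are irrelevant. *)
Definition has_type (n : nat) (P : {set n.-bseq 'I_n})
    (r : nat) (i k : nat -> nat) : bool :=
  [forall s in P, has (fun j => size s == i j) (index_iota 1 r.+1)] &&
  all (fun j => #|[set s in P | size s == i j]| == k j) (index_iota 1 r.+1).

Definition AP_partitions (n m r : nat) (i k : nat -> nat) :
    {set {set n.-bseq 'I_n}} :=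
  [set P | AP_partition m P & has_type P r i k].

Definition multinomial (r : nat) (k : nat -> nat) : nat :=
  (\sum_(1 <= j < r.+1) k j)`! %/ \prod_(1 <= j < r.+1) (k j)`!.

(* Main.v *)
(* Record an m-AP-partition by the function s on Z_n giving, for each cell c, the
   number of cells that follow c in its block.  The functions so obtained are
   those with s (c + m) = s c - 1 whenever s c > 0: the condition is local, and
   a block starts at c exactly when s (c - m) = 0.  Reading s at the heads in
   cyclic order gives a cyclic word of block lengths (each diminished by 1).
   The partitions in which 0 is a head correspond bijectively to the linear
   words of the given type, so counting partitions with a marked head in two ways
   gives the formula.

   Scanned from left to right, s is produced by a queue holding its last m
   values: a positive value is decremented and put back, a zero is replaced by
   the next letter of the word.  By the hypothesis on k_1 some rotation of the
   word ends with (m - 1)(i_r - 1) singletons.  For such a word the queue is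
   flushed by the time the word is exhausted; hence no block crosses the origin,
   and the word determines s and can be realised. *)

Require Import Defs.
From mathcomp Require Import all_boot all_order all_algebra.
From mathcomp Require Import zify.

Set Implicit Arguments.
Unset Strict Implicit.
Unset Printing Implicit Defensive.

Import GRing.Theory.

(** * Linear sequences scanned by a queue *)

(* A link (p, x) consists of the values at the cells c - m and c. *)
Definition link_ok (p : nat * nat) := (p.1 == 0) || (p.2 == p.1.-1).
Definition opening (p : nat * nat) := p.1 == 0.
Definition letters (z : seq (nat * nat)) := [seq p.2 | p <- z & opening p].

Definition chain (q s : seq nat) := zip (q ++ s) s.

Lemma chain_cons a q x s : chain (a :: q) (x :: s) = (a, x) :: chain (rcons q x) s.
Proof. by rewrite /chain cat_rcons. Qed.

(** The head of the queue decides whether the next value is its predecessor or the next letter, so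
    both scans pass through the same queues. *)
Lemma chain_inj q s s' : 0 < size q -> size s = size s' ->
  all link_ok (chain q s) -> all link_ok (chain q s') ->
  letters (chain q s) = letters (chain q s') -> s = s'.
Proof.
elim: s q s' => [|x s IH] [|a q] [|x' s'] // _ [ss'].
rewrite !chain_cons /= => /andP[xok sok] /andP[xok' sok'].
have q1 y : 0 < size (rcons q y) by rewrite size_rcons.
rewrite /letters /=; move: xok xok'; rewrite /link_ok /opening /=.
case: (a == 0) => /= [_ _ [exx'] E|/eqP exx /eqP exx' E]; subst; congr (_ :: _);
  exact: IH (q1 _) ss' sok sok' E.
Qed.

(* Slot j drops to 0 after j + (q_j - 1)(m - 1) visits to other slots, where m is
   the size of q; each of these visits reads at most one letter of the word. *)
Definition safe (q : seq nat) (u : nat) :=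
  forall j, j < size q -> 0 < nth 0 q j -> j + (nth 0 q j).-1 * (size q).-1 <= u.

(* The last condition makes the queue safe again after each letter of w'. *)
Definition clears (q w : seq nat) := exists w' u,
  [/\ w = w' ++ nseq u 0, safe q u & all (fun x => x * (size q).-1 <= u) w'].

(** A positive last slot [v] is charged [size q + v.-1 * size q], which is [v * size q]. *)
Lemma safe_rcons q v u :
  (forall j, j < size q -> 0 < nth 0 q j -> j + (nth 0 q j).-1 * size q <= u) ->
  v * size q <= u -> safe (rcons q v) u.
Proof.
move=> qs vs j; rewrite size_rcons ltnS nth_rcons leq_eqVlt /=.
case: ltngtP => //= [jq|->] _; first exact: qs.
by case: v vs => // v; rewrite mulSn.
Qed.

Lemma clears_skip a q w : clears (a.+1 :: q) w -> clears (rcons q a) w.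
Proof.
case=> w' [u [-> qs w's]]; exists w', u; split=> //.
  apply: safe_rcons => [j jq qj|]; last exact: (qs 0).
  by apply: leq_trans (qs j.+1 jq qj); rewrite /= addSn leqnSn.
by rewrite size_rcons.
Qed.

Lemma clears_read x q w : clears (0 :: q) (x :: w) -> clears (rcons q x) w.
Proof.
case=> -[|y w'] [u [E qs w's]].
  (* The letter read is one of the trailing zeros: [u] falls by one, and so does the index of every
     remaining slot. *)
  case: u E qs w's => // u [-> ->] qs _; exists [::], u; split=> //.
  apply: safe_rcons => // j jq qj.
  by rewrite -ltnS; apply: leq_trans (qs j.+1 jq qj).
case: E w's => <- -> /= /andP[xs w's]; exists w', u; split=> //.
  apply: safe_rcons => // j jq qj.
  by apply: leq_trans (qs j.+1 jq qj); rewrite /= addSn leqnSn.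
by rewrite size_rcons.
Qed.

(** With no letter left [u] is 0, and [safe] then allows no positive slot beyond the first. *)
Lemma clears_nil q : clears (0 :: q) [::] -> q = nseq (size q) 0.
Proof.
case=> [] [|? ?] [[|?] [//= _ qs _]]; apply/all_pred1P/(all_nthP 0) => j jq /=.
by rewrite eqn0Ngt; apply/negP => /(qs j.+1 jq).
Qed.

(** [drop (size s) (q ++ s)] is the queue left after scanning [s]; each step of the scan preserves
    [clears]. *)
Lemma clears_final q s : 0 < size q -> all link_ok (chain q s) ->
  clears q (letters (chain q s)) -> clears (drop (size s) (q ++ s)) [::].
Proof.
elim: s q => [|x s IH] [|a q] // _; first by rewrite drop0 cats0.
rewrite chain_cons /letters /link_ok /opening /= => /andP[xok sok].
rewrite -cat_rcons => qc; apply: IH; rewrite ?size_rcons //.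
case: a xok qc => [_|a /eqP/= ->] /=; [exact: clears_read | exact: clears_skip].
Qed.

(** Each step lowers [sumn q + sumn (map succn w)] by one: reading [x] removes [x.+1] from the word
    and adds [x] to the queue. By [clears_nil] a zero head finds no letter left only when this sum
    is 0. *)
Lemma chain_exists q w : 0 < size q -> clears q w ->
  exists s, [/\ size s = sumn q + sumn (map succn w), all link_ok (chain q s),
    letters (chain q s) = w & drop (size s) (q ++ s) = nseq (size q) 0].
Proof.
move E: (sumn q + _) => N; elim: N q w E => [|N IH] [|a q] w // E _ qc.
  case: w E qc => [|x w] /=; last lia.
  rewrite addn0 => E _; exists [::]; split=> //; rewrite cats0 drop0.
  exact/natnseq0P/eqP.
case: a E qc => [|a] E qc.
  case: w E qc => [|x w] E qc.
    by have:= clears_nil qc; move: E => /= E Eq; rewrite Eq sumn_nseq in E; lia.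
  have [||s [ss sok sw sd]] := IH (rcons q x) w _ _ (clears_read qc).
  - by move: E; rewrite /= sumn_rcons; lia.
  - by rewrite size_rcons.
  exists (x :: s); rewrite chain_cons /= ss; split=> //.
  - by rewrite /letters /= -/(letters _) sw.
  - by rewrite -cat_rcons -ss sd size_rcons.
have [||s [ss sok sw sd]] := IH (rcons q a) w _ _ (clears_skip qc).
- by move: E; rewrite /= sumn_rcons; lia.
- by rewrite size_rcons.
exists (a :: s); rewrite chain_cons /= ss; split=> //.
- by rewrite sok /link_ok /= eqxx.
- by rewrite -cat_rcons -ss sd size_rcons.
Qed.

(** * Cyclic sequences and their words *)

Definition links (m : nat) (s : seq nat) := zip (rotr m s) s.
Definition tiles m s := all link_ok (links m s).
Definition word m s := letters (links m s).
(** The default link [(1, 0)] is not opening, so the empty sequence is not headed. *)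
Definition headed m s := opening (nth (1, 0) (links m s) 0).

Lemma size_links m s : size (links m s) = size s.
Proof. by rewrite size_zip size_rotr minnn. Qed.

Lemma links_rot m d s : links m (rot d s) = rot d (links m s).
Proof.
rewrite /links -rot_rotr; have: size (rotr m s) = size s by rewrite size_rotr.
move: (rotr m s) => t ts; have [sd|/ltnW ds] := leqP (size s) d.
  by rewrite !rot_oversize // ?ts // size_zip ts minnn.
have st : size (take d t) = size (take d s) by rewrite !size_take ts.
rewrite -[in RHS](cat_take_drop d s) -[t in RHS](cat_take_drop d) zip_cat //.
have {3}<- : size (zip (take d t) (take d s)) = d.
  by rewrite size_zip st minnn size_takel.
by rewrite rot_size_cat -zip_cat // !size_drop ts.
Qed.

(** Round the cycle, the [m] cells before the origin are the last [m] cells; they form the initial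
    queue. *)
Lemma links_chain m s : m <= size s -> links m s = chain (drop (size s - m) s) s.
Proof.
move=> ms; rewrite /links /chain /rotr /rot.
set k := size s - m; set q := drop k s.
(* [zip] stops at the end of [s]; the surplus [drop k s] of the first list is set against [[::]]. *)
have -> : zip (q ++ s) s = zip ((q ++ take k s) ++ drop k s) (s ++ [::]).
  by rewrite -catA cat_take_drop cats0.
rewrite zip_cat; first by case: (drop k s) => *; rewrite ?cats0.
by rewrite size_cat size_drop size_takel ?leq_subr // subKn ?subnKC // leq_subr.
Qed.

Lemma all_rot (T : eqType) (a : pred T) d s : all a (rot d s) = all a s.
Proof. by apply: perm_all; rewrite perm_rot. Qed.

Lemma tiles_rot m d s : tiles m (rot d s) = tiles m s.
Proof. by rewrite /tiles links_rot all_rot. Qed.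

Lemma perm_word_rot m d s : perm_eq (word m (rot d s)) (word m s).
Proof.
by rewrite /word links_rot; apply/perm_map/perm_filter; rewrite perm_rot.
Qed.

(** [d] is the position of the opening link that carries letter number [p], counted from 0. *)
Lemma letters_rot z p : p < size (letters z) -> exists d, [/\ d < size z,
  opening (nth (1, 0) z d), count opening (take d z) = p &
  letters (rot d z) = rot p (letters z)].
Proof.
rewrite size_map size_filter => pz.
have [d [dz od pd]] : exists d, [/\ d < size z, opening (nth (1, 0) z d) &
    count opening (take d z) = p].
  elim: z p pz => // x z IH p /=; case ox: (opening x) => /=; last first.
    by move/IH=> [d [dz od pd]]; exists d.+1; rewrite /= ox pd.
  case: p => [|p] => [_|]; first by exists 0; rewrite ox.
  by rewrite ltnS => /IH[d [dz od pd]]; exists d.+1; rewrite /= ox pd.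
exists d; split=> //.
have sp : size (letters (take d z)) = p by rewrite size_map size_filter.
rewrite -[z in RHS](cat_take_drop d) /letters /rot !filter_cat !map_cat.
by rewrite drop_size_cat ?take_size_cat.
Qed.

(** A maximum of [s] can only sit at an opening link, as every other link strictly decreases; hence
    it is a letter. *)
Lemma all_leq_word m s a : tiles m s ->
  all (leq^~ a) (word m s) -> all (leq^~ a) s.
Proof.
move=> /allP st /allP sa; apply/(all_nthP 0).
case E: (size s) => [//|N] i0 i0N.
have [i _ imax] := @arg_maxnP 'I_N.+1 ord0 xpredT (fun i => nth 0 s i) isT.
apply: leq_trans (imax (Ordinal i0N) isT) _.
have zi : nth (0, 0) (links m s) i = (nth 0 (rotr m s) i, nth 0 s i).
  by rewrite nth_zip // size_rotr.
have zin : nth (0, 0) (links m s) i \in links m s.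
  by rewrite mem_nth // size_links E.
have /(nthP 0)[j jN jE]: nth 0 (rotr m s) i \in s.
  by rewrite -(mem_rotr m) mem_nth // size_rotr E.
rewrite E in jN; move: (imax (Ordinal jN) isT) (st _ zin); rewrite /= jE zi /link_ok.
case E1: (nth 0 (rotr m s) i) => [|v] /= vi; last by move/eqP=> E2;
  rewrite E2 ltnn in vi.
by move=> _; apply: sa; apply/mapP; exists (0, nth 0 s i); rewrite // mem_filter;
  move: zin; rewrite zi E1.
Qed.

(** * Bijection between headed tilings and words *)

(** With [a] equal to i_r - 1, this is the final run of singletons that the hypothesis on k_1
    provides up to rotation. *)
Definition ends_flat m a w := exists w', w = w' ++ nseq (a * m.-1) 0.

(** Take [u] to be a(m - 1): slot [j] costs at most (m - 1) + (a - 1)(m - 1). *)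
Lemma ends_flat_clears m a q w : ends_flat m a w -> size q = m ->
  all (leq^~ a) q -> all (leq^~ a) w -> clears q w.
Proof.
case=> w' -> <- /(all_nthP 0) qa; rewrite all_cat => /andP[/allP w'a _].
exists w', (a * (size q).-1); split=> //.
  move=> j jq qj; apply: leq_trans (leq_mul (qa j jq) (leqnn _)).
  by move: jq qj; case: (size q) => //= n jn; case: (nth 0 q j) => // v _;
    rewrite mulSn leq_add2r.
by apply/allP=> x /w'a xa; rewrite leq_mul.
Qed.

Lemma headed_queue m s : 0 < m <= size s -> headed m s =
  (nth 0 (drop (size s - m) s) 0 == 0).
Proof.
case/andP=> m0 ms; have s0 := leq_trans m0 ms.
rewrite /headed nth_zip ?size_rotr // /opening /= nth_cat size_drop subKn // m0.
by congr (_ == _); apply: set_nth_default; rewrite size_drop subKn.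
Qed.

(** The last [m] values are at once the queue before the scan and the queue after it. After the scan
    no letter is left, and the first slot is 0 because cell 0 is a head; so [clears_nil] applies. *)
Lemma tiles_aligned m a s : 0 < m <= size s -> tiles m s -> headed m s ->
  all (leq^~ a) (word m s) -> ends_flat m a (word m s) ->
  drop (size s - m) s = nseq m 0.
Proof.
move=> msn st sh wa we; case/andP: (msn) => m0 ms.
have sa := all_leq_word st wa.
move: sh; rewrite headed_queue //.
move: st wa we; rewrite /tiles /word links_chain //.
have: size (drop (size s - m) s) = m by rewrite size_drop subKn.
have: all (leq^~ a) (drop (size s - m) s).
  by rewrite -(cat_take_drop (size s - m) s) all_cat in sa; case/andP: sa.
have: drop (size s) (drop (size s - m) s ++ s) = drop (size s - m) s.
  by rewrite drop_cat size_drop subKn // ltnNge ms.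
move: (drop _ s) => q qE qa qm st wa we q0.
have := clears_final _ st (ends_flat_clears we qm qa wa); rewrite qE qm => /(_ m0).
by case: q q0 qm {qE qa st wa we} => [|x q] /=;
  [move=> _ <-| move=> /eqP-> <- /clears_nil ->; rewrite /= size_nseq].
Qed.

Lemma word_inj_flat m a s s' : size s = size s' -> 0 < m <= size s ->
  tiles m s -> tiles m s' -> headed m s -> headed m s' ->
  word m s = word m s' -> all (leq^~ a) (word m s) -> ends_flat m a (word m s) ->
  s = s'.
Proof.
move=> ss' ms st st' sh sh' E wa we; case/andP: (ms) => m0 msn.
have al := tiles_aligned ms st sh wa we.
have al' : drop (size s' - m) s' = nseq m 0.
  by apply: (@tiles_aligned m a); rewrite -?ss' -?E.
move: st st' E; rewrite /tiles /word !links_chain -?ss' //.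
rewrite al ss' al'; apply: chain_inj; by rewrite ?size_nseq.
Qed.

(** If [d < d'], the first [d'] entries of [z'] are [d' - d] entries, beginning with an opening one,
    followed by the first [d] entries of [z]; the counts would differ. *)
Lemma rot_opening_leq z z' d d' : d' < size z' -> rot d z = rot d' z' ->
  opening (nth (1, 0) z' 0) ->
  count opening (take d z) = count opening (take d' z') -> d' <= d.
Proof.
move=> dz' zz' oz' E; rewrite leqNgt; apply/negP => ltdd'.
have d'E : d' = d' - d + d by rewrite subnK // ltnW.
have zE : z = rot (d' - d) z'.
  by apply: (@rot_inj d); rewrite zz' -rotD addnC -?d'E // ltnW.
move: E; rewrite {}zE {2}d'E takeD count_cat /rot take_cat size_drop.
rewrite ifT; last by rewrite ltn_subRL -d'E.
move/eqP; rewrite -{1}[count _ _]add0n eqn_add2r eq_sym.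
have : 0 < d' - d by rewrite subn_gt0.
by case: (d' - d) z' oz' dz' {zz'} => // e [|x z'] //= ->.
Qed.

Lemma headed_rot m d s : d < size s ->
  opening (nth (1, 0) (links m s) d) -> headed m (rot d s).
Proof.
by move=> ds; rewrite /headed links_rot /rot nth_cat size_drop size_links subn_gt0 ds nth_drop addn0.
Qed.

(** Rotated to head number [p], both sequences have the same flat word, so they agree. Each rotation
    skips exactly [p] heads, whence the offsets agree too. *)
Lemma word_inj m a p s s' : size s = size s' -> 0 < m <= size s ->
  tiles m s -> tiles m s' -> headed m s -> headed m s' ->
  word m s = word m s' -> all (leq^~ a) (word m s) ->
  p < size (word m s) -> ends_flat m a (rot p (word m s)) -> s = s'.
Proof.
move=> ss' ms st st' sh sh' E wa pw we.
have [d [ds od pd dE]] := letters_rot pw.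
have [|d' [ds' od' pd' dE']] := @letters_rot (links m s') p.
  by rewrite -/(word m s') -E.
rewrite !size_links in ds ds'.
have R : rot d s = rot d' s'.
  apply: (@word_inj_flat m a); rewrite ?size_rot ?tiles_rot ?headed_rot //.
  - by rewrite /word !links_rot dE dE' -/(word m s) E.
  - by rewrite /word links_rot dE all_rot.
  - by rewrite /word links_rot dE.
have RL : rot d (links m s) = rot d' (links m s') by rewrite -!links_rot R.
have dd' : d = d'.
  apply/eqP; rewrite eqn_leq.
  by rewrite (rot_opening_leq _ RL) ?(rot_opening_leq _ (esym RL)) ?size_links ?pd.
by move: R; rewrite dd'; apply: rot_inj.
Qed.

(** The scan started on a zero queue ends on a zero queue, so its output closes up into a cycle. *)
Lemma word_surj_flat m a w : 0 < m <= sumn (map succn w) ->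
  all (leq^~ a) w -> ends_flat m a w ->
  exists s, [/\ size s = sumn (map succn w), tiles m s, headed m s & word m s = w].
Proof.
case/andP=> m0 mw wa we.
have sq : size (nseq m 0) = m by rewrite size_nseq.
have qa : all (leq^~ a) (nseq m 0) by apply/allP=> x /nseqP[->].
have [|s [ss st sw sd]] := chain_exists _ (ends_flat_clears we sq qa wa);
  first by rewrite sq.
rewrite sumn_nseq mul0n add0n in ss.
have sE : drop (size s - m) s = nseq m 0.
  by move: sd; rewrite sq drop_cat sq ss ltnNge mw.
exists s; rewrite headed_queue ?ss ?m0 // -ss sE nth_nseq if_same.
by rewrite /tiles /word links_chain ?ss // -ss sE.
Qed.

Lemma word_surj m a p w : 0 < m <= sumn (map succn w) ->
  all (leq^~ a) w -> p < size w -> ends_flat m a (rot p w) ->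
  exists s, [/\ size s = sumn (map succn w), tiles m s, headed m s & word m s = w].
Proof.
move=> mw wa pw we.
have sumE : sumn (map succn (rot p w)) = sumn (map succn w).
  by apply: perm_sumn; apply/perm_map; rewrite perm_rot.
have [|||s [ss st sh sw]] := @word_surj_flat m a (rot p w); rewrite ?sumE ?all_rot //.
(* This rotation of the word undoes the one by [p]; the reduction modulo [size w] matters for
   [p = 0]. *)
have [|d [ds od _ dE]] := @letters_rot (links m s) ((size w - p) %% size w).
  by rewrite -/(word m s) sw size_rot ltn_mod (leq_ltn_trans _ pw).
exists (rot d s); rewrite size_rot ss sumE tiles_rot /word links_rot; split=> //.
  by rewrite headed_rot // -(size_links m).
rewrite dE -/(word m s) sw; case: p {we sumE ss st sh sw dE} pw => [|p] pw.
  by rewrite subn0 modnn !rot0.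
rewrite modn_small; last by rewrite ltn_subrL (leq_ltn_trans _ pw).
have := rotK p.+1 w; rewrite /rotr size_rot; exact.
Qed.

(** * Distinct permutations and the multinomial coefficient *)

Lemma sum_count_mem (T : eqType) (u w : seq T) : uniq u -> {subset w <= u} ->
  \sum_(x <- u) count_mem x w = size w.
Proof.
move=> uu wu; under eq_bigr => x _ do rewrite -sum1_count big_mkcond /=.
rewrite exchange_big /= -sum1_size big_seq [RHS]big_seq; apply: eq_bigr => y yw.
transitivity (count_mem y u); last by rewrite count_uniq_mem // wu.
by rewrite -sum1_count [RHS]big_mkcond; apply: eq_bigr => x _; rewrite /= eq_sym.
Qed.

(** Sort the permutations by first letter [x]: deleting one [x] divides the product of factorials by
    the multiplicity of [x], and the multiplicities add up to [size w]. *)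
Lemma prod_fact_permutations (T : eqType) (u w : seq T) :
  uniq u -> {subset w <= u} ->
  (\prod_(x <- u) (count_mem x w)`!) * size (permutations w) = (size w)`!.
Proof.
move=> uu; move E: (size w) => N; elim: N w E => [|N IH] w E wu.
  by case: w E wu => //= _ _; rewrite big1.
rewrite (perm_size (permutationsE _)) ?E // size_allpairs_dep sumnE big_map.
rewrite big_distrr /= factS -E -(sum_count_mem (undup_uniq w)) ?big_distrl /=;
  last first.
  by move=> x; rewrite mem_undup.
rewrite big_seq [RHS]big_seq; apply: eq_bigr => x; rewrite mem_undup => xw.
rewrite -(IH (rem x w)) ?size_rem ?E //; last by move=> y /mem_rem /wu.
rewrite mulnA; congr (_ * _); rewrite !(bigD1_seq x) ?wu //= mulnA; congr (_ * _).
  rewrite count_mem_rem eqxx subn1 -[in LHS](@prednK (count_mem x w)) ?factS ?prednK //;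
    by rewrite -has_count has_pred1.
by apply: eq_bigr => y yx; rewrite count_mem_rem eq_sym (negPf yx) subn0.
Qed.

(** * A pigeonhole argument on cyclic windows *)

Lemma sum_nth_count (T : Type) (x0 : T) (a : pred T) s n : size s = n ->
  \sum_(i < n) a (nth x0 s i) = count a s.
Proof.
move=> <-; rewrite -sum1_count [RHS]big_mkcond [RHS](big_nth x0) big_mkord.
by apply: eq_bigr => i _; case: (a _).
Qed.

Lemma nth_rotC (T : Type) (x0 : T) s i j : i < size s -> j < size s ->
  nth x0 (rot i s) j = nth x0 (rot j s) i.
Proof.
have nth_rot0 t l : l < size t -> nth x0 (rot l t) 0 = nth x0 t l.
  by move=> lt; rewrite /rot nth_cat size_drop subn_gt0 lt nth_drop addn0.
by move=> lti ltj; rewrite -nth_rot0 ?size_rot // rot_rot nth_rot0 ?size_rot.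
Qed.

(** Each entry lies in [C] of the cyclic windows. The induction lengthens all windows by one entry;
    as [p] varies, the added entries run through [rot C s]. *)
Lemma sum_count_window (T : Type) (a : pred T) C s : C <= size s ->
  \sum_(p < size s) count a (take C (rot p s)) = C * count a s.
Proof.
case: s => [|x0 s]; first by rewrite leqn0 => /eqP->; rewrite big_ord0.
elim: C => [_|C IH ltC]; first by rewrite big1 // => p _; rewrite take0.
have cE : count a (x0 :: s) = count a (rot C (x0 :: s)).
  by rewrite -[in LHS](cat_take_drop C (x0 :: s)) !count_cat addnC.
rewrite mulSnr -IH; last exact: ltnW.
rewrite cE -(sum_nth_count x0 _ (size_rot C _)) -big_split; apply: eq_bigr => p _ /=.
by rewrite (take_nth x0) ?size_rot // -cats1 count_cat /= addn0 nth_rotC.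
Qed.

(** The windows of length [C] contain fewer nonzero letters in total than there are windows, so one
    of them is all zeros; it is rotated to the end. *)
Lemma exists_flat_rot C w : C * count (predC1 0) w < size w -> 0 < count (predC1 0) w ->
  exists2 p, p < size w & exists w', rot p w = w' ++ nseq C 0.
Proof.
move=> Cw w0; have Cs : C <= size w.
  by apply: leq_trans (ltnW Cw); rewrite leq_pmulr.
have /existsP[p] : [exists p : 'I_(size w), count (predC1 0) (take C (rot p w)) == 0].
  apply: contraTT Cw; rewrite negb_exists => /forallP np.
  rewrite -leqNgt -sum_count_window // -{1}[size w]card_ord -sum1_card.
  by apply: leq_sum => p _; rewrite lt0n np.
rewrite -leqn0 leqNgt -has_count => /hasPn np.
have rE : rot C (rot p w) = drop C (rot p w) ++ nseq C 0.
  rewrite [LHS]/rot; congr (_ ++ _).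
  have {2}<- : size (take C (rot p w)) = C by rewrite size_takel ?size_rot.
  by apply/all_pred1P/allP => x /np; rewrite /= negbK.
have s0 : 0 < size w by apply: leq_ltn_trans Cw.
rewrite (rot_add_mod (ltnW (ltn_ord p)) Cs) in rE.
(* The rotation index [C + p] is reduced below [size w]. *)
have [Cp|Cp|Cp] := ltngtP (C + p) (size w).
- by exists (C + p) => //; rewrite (ltnW Cp) in rE; exists (drop C (rot p w)).
- exists (C + p - size w); last by rewrite leqNgt Cp in rE; exists (drop C (rot p w)).
  by rewrite ltn_subLR ?(ltnW Cp) // -addnS leq_add.
- by exists 0; rewrite // rot0; exists (drop C (rot p w));
  rewrite -rE Cp leqnn rot_size.
Qed.

(** * Double counting of tilings and heads *)

Definition vals n (t : n.-tuple 'I_n) : seq nat := [seq val c | c <- t].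

(** Entries in ['I_n] are enough, and make the set finite: fewer than [n] cells follow a given cell
    in its block. *)
Definition tilings n m (w0 : seq nat) : {set n.-tuple 'I_n} :=
  [set t | tiles m (vals t) && perm_eq (word m (vals t)) w0].

Lemma size_vals n (t : n.-tuple 'I_n) : size (vals t) = n.
Proof. by rewrite size_map size_tuple. Qed.

Lemma vals_inj n : injective (@vals n).
Proof. by move=> t t' /(inj_map val_inj)/val_inj. Qed.

Lemma vals_rot n d (t : n.-tuple 'I_n) : vals [tuple of rot d t] = rot d (vals t).
Proof. exact: map_rot. Qed.

Lemma rot_tilings n m w0 d (t : n.-tuple 'I_n) :
  ([tuple of rot d t] \in tilings n m w0) = (t \in tilings n m w0).
Proof. by rewrite !inE vals_rot tiles_rot (permPl (perm_word_rot _ _ _)). Qed.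

Lemma vals_surj n s : size s = n -> all (leq^~ n.-1) s ->
  exists t : n.-tuple 'I_n, vals t = s.
Proof.
case: n => [/size0nil -> _|n ss sn]; first by exists [tuple].
have st : size (map (@inord n) s) == n.+1 by rewrite size_map ss.
exists (Tuple st : n.+1.-tuple 'I_n.+1); rewrite /vals /= -map_comp.
by apply: map_id_in => c /(allP sn) cn; rewrite /= inordK.
Qed.

(** [word m] maps the headed tilings bijectively onto the reorderings of [w0], by [word_inj] and
    [word_surj]. *)
Lemma card_headed_tilings n m a w0 : 0 < m <= n -> n = sumn (map succn w0) ->
  a < n -> all (leq^~ a) w0 ->
  (forall w, perm_eq w w0 -> exists2 p, p < size w & ends_flat m a (rot p w)) ->
  #|[set t in tilings n m w0 | headed m (vals t)]| = size (permutations w0).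
Proof.
move=> mn nE an w0a flat; have n0 := leq_ltn_trans (leq0n a) an.
set C0 := [set t in _ | _].
have wa w : perm_eq w w0 -> all (leq^~ a) w by move/perm_all->.
rewrite cardE -(size_map (fun t => word m (vals t))); apply/perm_size/uniq_perm.
- rewrite map_inj_in_uniq ?enum_uniq // => t t'; rewrite !mem_enum !inE.
  move=> /andP[/andP[tt tw] th] /andP[/andP[tt' tw'] th'] E; apply: vals_inj.
  have [p pw wf] := flat _ tw.
  by apply: word_inj wf; rewrite ?size_vals // wa.
- exact: permutations_uniq.
move=> w; rewrite mem_permutations; apply/mapP/idP => [[t]|ww].
  by rewrite mem_enum !inE => /andP[/andP[_ ?] _] ->.
have [p pw wf] := flat _ ww.
have sumE : sumn (map succn w) = n by rewrite nE; apply/perm_sumn/perm_map.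
have [|s [ss st sh sw]] := word_surj _ (wa _ ww) pw wf; first by rewrite sumE.
have [||t tE] := @vals_surj n s; rewrite ?ss ?sumE //.
  apply: (@all_leq_word m) => //; rewrite sw.
  by apply: sub_all (wa _ ww) => x xa; rewrite -ltnS prednK // (leq_ltn_trans xa).
by exists t; rewrite ?mem_enum ?inE tE ?st ?sw ?ww ?sh.
Qed.

Lemma card_tilings n m a w0 : 0 < m <= n -> n = sumn (map succn w0) ->
  a < n -> all (leq^~ a) w0 ->
  (forall w, perm_eq w w0 -> exists2 p, p < size w & ends_flat m a (rot p w)) ->
  #|tilings n m w0| * size w0 = n * size (permutations w0).
Proof.
move=> mn nE an w0a flat.
rewrite -(card_headed_tilings mn nE an w0a flat) -sum_nat_const.
(* A tiling has as many heads as letters; [d] is a head when the rotation by [d] is headed. *)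
have wE t : t \in tilings n m w0 ->
    size w0 = \sum_(d < n) headed m (vals [tuple of rot d t]).
  rewrite inE => /andP[_ /perm_size <-]; rewrite size_map size_filter.
  rewrite -(@sum_nth_count _ (1, 0) _ _ n) ?size_links ?size_vals //.
  apply: eq_bigr => d _; rewrite /headed vals_rot links_rot /rot nth_cat size_drop.
  by rewrite subn_gt0 size_links size_vals ltn_ord nth_drop addn0.
rewrite (eq_bigr _ wE) exchange_big /=.
set N := #|_|; transitivity (\sum_(d < n) N); last by rewrite sum_nat_const card_ord.
apply: eq_bigr => d _; rewrite -big_mkcondr sum1_card /N.
(* Rotation by [d] carries the tilings with a head at [d] onto those with a head at 0. *)
rewrite -[RHS](@on_card_preimset _ _ (fun t : n.-tuple 'I_n => [tuple of rot d t])).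
  by apply: eq_card => t; rewrite [RHS]inE [RHS]inE rot_tilings.
apply: onW_bij; exists (fun t : n.-tuple 'I_n => [tuple of rotr d t]) => t;
  apply: val_inj.
  exact: rotK.
exact: rotrK.
Qed.

(** * Correspondence of AP-partitions with tilings *)

Definition AP_seq n m (x : 'I_n.+1) l : seq 'I_n.+1 :=
  mkseq (fun j => x + inZp m *+ j)%R l.

Lemma AP_blockP n m (s : seq 'I_n.+1) :
  reflect [/\ 0 < size s, uniq s & exists x, s = AP_seq m x (size s)] (AP_block m s).
Proof.
have E (x : 'I_n.+1) : map val (AP_seq m x (size s)) = mkseq (fun j => (x + j * m) %% n.+1) (size s).
  rewrite -map_comp; apply: eq_map => j /=.
  by rewrite Zp_mulrn /= modnMml modnDmr mulnC.
apply: (iffP and3P) => -[s0 us].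
  by move/existsP=> [x /eqP xs]; split=> //; exists x; apply: (inj_map val_inj);
    rewrite E.
by case=> x xs; split=> //; apply/existsP; exists x; rewrite -E -xs.
Qed.

Lemma mem_bseqE n (T : eqType) (B : n.-bseq T) y : (y \in B) = (y \in bseqval B).
Proof. by []. Qed.

(** As blocks are nonempty, injectivity of [underlying] and disjointness merge into one condition:
    blocks that share a cell are equal. *)
Lemma AP_partitionP n m (P : {set n.-bseq 'I_n}) : reflect
  [/\ forall B, B \in P -> AP_block m B,
      forall y, exists2 B : n.-bseq 'I_n, B \in P & y \in B &
      forall (B B' : n.-bseq 'I_n) y,
        B \in P -> B' \in P -> y \in B -> y \in B' -> B = B']
  (AP_partition m P).
Proof.
have memU (B : n.-bseq 'I_n) y : (y \in underlying B) = (y \in B) by rewrite inE.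
apply: (iffP and3P) => [[/forall_inP Pb /dinjectiveP inj /and3P[/eqP cov /trivIsetP tri _]] | [Pb cov tri]].
  split=> // [y | B B' y BP B'P yB yB'].
    have: y \in cover [set underlying B | B in P] by rewrite cov inE.
    case/bigcupP=> U /imsetP[B BP ->]; rewrite memU => yB; by exists B.
  apply: inj => //; apply/eqP;
    apply: contraTT yB => /(tri _ _ (imset_f _ BP) (imset_f _ B'P)).
  by move/disjointFl => /(_ y); rewrite !memU => ->.
have inj (B B' : n.-bseq 'I_n) : B \in P -> B' \in P ->
    ~~ [disjoint underlying B & underlying B'] -> B = B'.
  by move=> BP B'P /pred0Pn[y /andP[yB yB']]; apply: (tri B B' y) => //; rewrite -memU.
have ne (B : n.-bseq 'I_n) : B \in P -> exists y, y \in B.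
  move/Pb/and3P => [+ _ _]; case E: (bseqval B) => [//|y s] _.
  by exists y; rewrite mem_bseqE E mem_head.
split; first exact/forall_inP.
  apply/dinjectiveP => B B' BP B'P E; apply: inj => //; rewrite -E.
  by have [y yB] := ne B BP; apply/pred0Pn; exists y; rewrite /= memU yB.
apply/and3P; split.
- apply/eqP/setP => y; rewrite inE; have [B BP yB] := cov y.
  by apply/bigcupP; exists (underlying B); rewrite ?memU ?imset_f.
- apply/trivIsetP => _ _ /imsetP[B BP ->] /imsetP[B' B'P ->]; apply: contraR.
  by move/(inj _ _ BP B'P) ->.
- by apply/imsetP => -[B /ne[y yB] /setP/(_ y)]; rewrite memU yB inE.
Qed.

(** The default 0 is not reached for an AP-partition, whose blocks cover every cell. *)
Definition remaining n (P : {set n.+1.-bseq 'I_n.+1}) : n.+1.-tuple 'I_n.+1 :=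
  [tuple inord (if [pick B in P | c \in (B : seq _)] is Some B
                then (size B).-1 - index c B else 0) | c < n.+1].

(** [insub_bseq] would replace an overlong list by the empty one; [val_AP_block] excludes this for
    stepwise [t], since the cells listed are distinct. *)
Definition AP_blocks n m (t : n.+1.-tuple 'I_n.+1) : {set n.+1.-bseq 'I_n.+1} :=
  [set insub_bseq n.+1 (AP_seq m c (tnth t c).+1) |
     c : 'I_n.+1 & tnth t (c - inZp m)%R == 0 :> nat].

Lemma links_vals n m (t : n.+1.-tuple 'I_n.+1) : m < n.+1 ->
  links m (vals t) =
  [seq (val (tnth t (c - inZp m)%R), val (tnth t c)) | c <- enum 'I_n.+1].
Proof.
move=> mn; apply: (@eq_from_nth _ (0, 0)).
  by rewrite size_links size_vals size_map size_enum_ord.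
rewrite size_links size_vals => c cn.
rewrite nth_zip ?size_rotr // [RHS](nth_map ord0) ?size_enum_ord // !(tnth_nth ord0).
have -> : nth ord0 (enum 'I_n.+1) c = Ordinal cn by apply/val_inj;
  rewrite /= nth_enum_ord.
have nthE l : l < n.+1 -> nth 0 (vals t) l = nth ord0 t l.
  by move=> ln; rewrite (nth_map ord0) ?size_tuple.
congr (_, _); rewrite ?nthE //= modnDmr (modn_small mn) /rotr /rot size_vals nth_cat.
rewrite size_drop size_vals subKn ?(ltnW mn) //; case: ltnP => cm.
  rewrite nth_drop nthE ?(addnC c) ?modn_small //; lia.
rewrite nth_take ?nthE; try lia.
have -> : c + (n.+1 - m) = c - m + n.+1 by lia.
rewrite modnDr modn_small //; lia.
Qed.

Definition stepwise n m (t : n.+1.-tuple 'I_n.+1) : Prop :=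
  forall c, 0 < tnth t c -> tnth t (c + inZp m)%R = (tnth t c).-1 :> nat.

Lemma tilesP n m (t : n.+1.-tuple 'I_n.+1) : m < n.+1 ->
  reflect (stepwise m t)
          (tiles m (vals t)).
Proof.
move=> mn; rewrite /tiles links_vals // all_map.
apply: (iffP allP) => [ok c tc | ok c _].
  have /= := ok (c + inZp m)%R; rewrite mem_enum addrK => /(_ isT).
  by rewrite /link_ok /= eqn0Ngt tc => /eqP.
rewrite /link_ok /= eqn0Ngt; case: ltnP => //= tc.
by rewrite -{1}(subrK (inZp m) c) ok.
Qed.

Lemma count_word n m (t : n.+1.-tuple 'I_n.+1) v : m < n.+1 ->
  count_mem v (word m (vals t)) =
  #|[set c | (tnth t (c - inZp m)%R == 0 :> nat) & (tnth t c == v :> nat)]|.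
Proof.
move=> mn; rewrite /word /letters links_vals // filter_map -map_comp.
rewrite count_map count_filter enumT cardE /enum_mem size_filter.
by apply: eq_count => c; rewrite /= inE andbC.
Qed.

Lemma stepwiseE n m (t : n.+1.-tuple 'I_n.+1) c j :
  stepwise m t ->
  j <= tnth t c -> tnth t (c + inZp m *+ j)%R = tnth t c - j :> nat.
Proof.
move=> step; elim: j => [|j IH] jc; first by rewrite mulr0n addr0 subn0.
by rewrite mulrSr addrA step IH ?subnS // ?subn_gt0 // ltnW.
Qed.

(** The value of [t] at a cell of the block reveals its index there. *)
Lemma AP_seq_uniq n m (t : n.+1.-tuple 'I_n.+1) c :
  stepwise m t ->
  uniq (AP_seq m c (tnth t c).+1).
Proof.
move=> step; apply/mkseq_uniqP => j j'; rewrite !inE !ltnS => jc jc'.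
move/(congr1 (fun x => val (tnth t x))); rewrite /= !stepwiseE //.
by move=> E; rewrite -(subKn jc) E subKn.
Qed.

Lemma val_AP_block n m (t : n.+1.-tuple 'I_n.+1) c :
  stepwise m t ->
  insub_bseq n.+1 (AP_seq m c (tnth t c).+1) = AP_seq m c (tnth t c).+1 :> seq _.
Proof.
move=> step; rewrite val_insubd.
by have := max_card (mem (AP_seq m c (tnth t c).+1));
  rewrite (card_uniqP (AP_seq_uniq c step)) card_ord => ->.
Qed.

Lemma AP_seqP n m (x y : 'I_n.+1) l :
  reflect (exists2 j, j < l & y = (x + inZp m *+ j)%R) (y \in AP_seq m x l).
Proof.
apply: (iffP mapP) => -[j]; first by rewrite mem_iota; exists j.
by move=> jl ->; exists j; rewrite ?mem_iota.
Qed.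

(** Walking back by [m] from a cell that is not a head raises the value by one; values are at most
    [n], so a head is reached. *)
Lemma AP_blocks_cover n m (t : n.+1.-tuple 'I_n.+1) y :
  stepwise m t ->
  exists c j, [/\ tnth t (c - inZp m)%R = 0 :> nat, j <= tnth t c &
    y = (c + inZp m *+ j)%R].
Proof.
move=> step; move Ev: (n - tnth t y) => v; elim: v y Ev => [|v IH] y Ev.
  exists y, 0; rewrite mulr0n addr0; split=> //; apply/eqP; rewrite eqn0Ngt.
  apply/negP => yp; have := step _ yp; rewrite subrK => ty.
  by move: (ltn_ord (tnth t (y - inZp m)%R)) yp Ev ty; lia.
case: (posnP (tnth t (y - inZp m)%R)) => [y0|yp].
  by exists y, 0; rewrite mulr0n addr0.
have := step _ yp; rewrite subrK => ty.
have [|c [j [c0 jc yE]]] := IH (y - inZp m)%R; first by move: yp Ev ty; lia.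
exists c, j.+1; split=> //; last by rewrite mulrSr addrA -yE subrK.
by move: yp; rewrite yE stepwiseE // subn_gt0.
Qed.

(** If [j < j'], cancelling [j] steps puts [c] strictly inside the block of [c'], so the cell before
    [c] has a positive value. *)
Lemma AP_blocks_disjoint n m (t : n.+1.-tuple 'I_n.+1) c c' j j' :
  stepwise m t ->
  tnth t (c - inZp m)%R = 0 :> nat -> tnth t (c' - inZp m)%R = 0 :> nat ->
  j <= tnth t c -> j' <= tnth t c' ->
  (c + inZp m *+ j = c' + inZp m *+ j')%R -> c = c'.
Proof.
move=> step; wlog jj' : c c' j j' / j <= j'.
  move=> W; have [/W|/ltnW/W] := leqP j j'; first exact.
  by move=> E ? ? ? ? ?; apply/esym/E.
move=> c0 c'0 jc j'c'; rewrite -(subnK jj') mulrnDr addrA => /addIr cE.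
case E: (j' - j) cE => [|d] cE; first by rewrite cE mulr0n addr0.
have dc : d < tnth t c' by move: E j'c'; lia.
move: c0; rewrite cE mulrSr addrA addrK stepwiseE ?(ltnW dc) //.
by move/eqP; rewrite subn_eq0 leqNgt dc.
Qed.

Lemma AP_partition_blocks n m (t : n.+1.-tuple 'I_n.+1) : m < n.+1 ->
  tiles m (vals t) -> AP_partition m (AP_blocks m t).
Proof.
move=> mn /(tilesP _ mn) step; apply/AP_partitionP; split.
- move=> _ /imsetP[c _ ->]; apply/AP_blockP; rewrite val_AP_block // size_mkseq.
  by split; [|exact: AP_seq_uniq|exists c].
- move=> y; have [c [j [c0 jc yE]]] := AP_blocks_cover y step.
  exists (insub_bseq n.+1 (AP_seq m c (tnth t c).+1)).
    by apply: imset_f; rewrite inE c0.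
  by rewrite mem_bseqE val_AP_block //; apply/AP_seqP; exists j.
move=> _ _ y /imsetP[c + ->] /imsetP[c' + ->]; rewrite !inE => /eqP c0 /eqP c'0.
rewrite !mem_bseqE !val_AP_block // => /AP_seqP[j jc ->] /AP_seqP[j' jc' E].
by rewrite (AP_blocks_disjoint step c0 c'0 jc jc' E).
Qed.

Lemma tnth_remaining n m (P : {set n.+1.-bseq 'I_n.+1}) (B : n.+1.-bseq 'I_n.+1) x l j :
  AP_partition m P -> B \in P -> B = AP_seq m x l :> seq _ -> j < l ->
  tnth (remaining P) (x + inZp m *+ j)%R = l.-1 - j :> nat.
Proof.
move=> /AP_partitionP[Pb _ Pd] BP BE jl; rewrite tnth_mktuple.
have yB : (x + inZp m *+ j)%R \in bseqval B by rewrite BE; apply/AP_seqP; exists j.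
case: pickP => [B' /andP[B'P yB'] | /(_ B)]; last by rewrite /= BP yB.
rewrite (Pd _ _ _ B'P BP yB' yB).
have sB : size B = l by rewrite BE size_mkseq.
have /AP_blockP[_ uB _] := Pb B BP.
have -> : index (x + inZp m *+ j)%R B = j.
  have <- : nth 0%R B j = (x + inZp m *+ j)%R by rewrite BE nth_mkseq.
  by rewrite index_uniq ?sB.
rewrite sB inordK // ltnS; apply: leq_trans (leq_subr _ _) _.
by rewrite -ltnS prednK ?(leq_ltn_trans _ jl) // -sB size_bseq.
Qed.

Lemma AP_partition_tiles n m (P : {set n.+1.-bseq 'I_n.+1}) : m < n.+1 ->
  AP_partition m P -> tiles m (vals (remaining P)).
Proof.
move=> mn Pm; apply/tilesP => // c cp.
have /AP_partitionP[Pb Pc _] := Pm.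
have [B BP cB] := Pc c; have /AP_blockP[_ _ [x xB]] := Pb B BP.
move: cB cp; rewrite mem_bseqE xB => /AP_seqP[j jl ->].
rewrite (tnth_remaining Pm BP xB jl) subn_gt0 => jl'.
by rewrite -addrA -mulrSr (tnth_remaining Pm BP xB) ?subnS // -ltn_predRL.
Qed.

Lemma remaining_blocks n m (t : n.+1.-tuple 'I_n.+1) : m < n.+1 ->
  tiles m (vals t) -> remaining (AP_blocks m t) = t.
Proof.
move=> mn tm; have Pm := AP_partition_blocks mn tm.
move/(tilesP _ mn): tm => step; apply: eq_from_tnth => y; apply: val_inj => /=.
have [c [j [c0 jc ->]]] := AP_blocks_cover y step.
have BP : insub_bseq n.+1 (AP_seq m c (tnth t c).+1) \in AP_blocks m t.
  by apply: imset_f; rewrite inE c0.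
by rewrite (tnth_remaining Pm BP (val_AP_block c step)) // stepwiseE.
Qed.

Lemma blocks_remaining n m (P : {set n.+1.-bseq 'I_n.+1}) : m < n.+1 ->
  AP_partition m P -> AP_blocks m (remaining P) = P.
Proof.
move=> mn Pm; have /AP_partitionP[Pb Pc Pd] := Pm.
have /(tilesP _ mn) step := AP_partition_tiles mn Pm.
have headP (B : n.+1.-bseq 'I_n.+1) x : B \in P -> B = AP_seq m x (size B) :> seq _ ->
    insub_bseq n.+1 (AP_seq m x (tnth (remaining P) x).+1) = B.
  move=> BP xB; apply: val_inj; rewrite /= val_AP_block //.
  have /AP_blockP[B0 _ _] := Pb B BP.
  have := tnth_remaining Pm BP xB B0; rewrite mulr0n addr0 subn0 => ->.
  by rewrite prednK.
(* The heads read off from [remaining P] are exactly the first cells of the blocks of [P]. *)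
have starts (B : n.+1.-bseq 'I_n.+1) x j : B \in P
  -> B = AP_seq m x (size B) :> seq _ ->
    j < size B -> (tnth (remaining P) (x + inZp m *+ j - inZp m)%R == 0 :> nat) = (j == 0).
  move=> BP xB jB; case: j jB => [|j] jB; last first.
    rewrite mulrSr addrA addrK (tnth_remaining Pm BP xB) ?(ltnW jB) //.
    by rewrite subn_eq0 leqNgt ltn_predRL jB.
  rewrite mulr0n addr0 eqxx; apply/negbNE/negP; rewrite -lt0n => xp.
  (* A positive value at [x - m] would make [x] a later cell of the block [B'] of [x - m]. Then
     [B' = B], and [x] occurs twice in [B]. *)
  have [B' B'P yB'] := Pc (x - inZp m)%R; have /AP_blockP[_ _ [x' xB']] := Pb B' B'P.
  move: yB' xp; rewrite mem_bseqE xB' => /AP_seqP[j' jl' xE].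
  rewrite xE (tnth_remaining Pm B'P xB' jl') subn_gt0 => jl.
  have {}xE : x = (x' + inZp m *+ j'.+1)%R by rewrite mulrSr addrA -xE subrK.
  have jB' : j'.+1 < size B' by rewrite -ltn_predRL.
  have BB' : B = B'.
    apply: (Pd _ _ x BP B'P); rewrite mem_bseqE.
      by rewrite xB; apply/AP_seqP; exists 0; rewrite ?mulr0n ?addr0.
    by rewrite xB' xE; apply/AP_seqP; exists j'.+1.
  have /AP_blockP[_ uB _] := Pb B BP.
  have E0 : nth 0%R B 0 = x by rewrite xB nth_mkseq // mulr0n addr0.
  have E1 : nth 0%R B j'.+1 = x by rewrite BB' xB' nth_mkseq // -xE.
  move/eqP: E1; rewrite -[X in _ == X]E0 nth_uniq // BB' //.
apply/setP => B; apply/imsetP/idP => [[c]|BP].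
  rewrite inE => c0 ->; have [B0 B0P cB0] := Pc c.
  have /AP_blockP[_ _ [x xB0]] := Pb B0 B0P.
  move: cB0 c0; rewrite mem_bseqE xB0 => /AP_seqP[j jl ->].
  rewrite (starts B0) // => /eqP->; rewrite mulr0n addr0 (headP B0) //.
have /AP_blockP[B0 _ [x xB]] := Pb B BP.
exists x; last by rewrite (headP B).
by have := starts B x 0 BP xB B0; rewrite mulr0n addr0 inE => ->.
Qed.

(** * Types as multisets of letters *)

Definition type_word r (i k : nat -> nat) : seq nat :=
  flatten [seq nseq (k j) (i j).-1 | j <- index_iota 1 r.+1].

Lemma sumn_type_word f r i k : sumn (map f (type_word r i k)) =
  \sum_(1 <= j < r.+1) k j * f (i j).-1.
Proof.
rewrite map_flatten sumn_flatten -!map_comp sumnE big_map; apply: eq_bigr => j _.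
by rewrite /= map_nseq sumn_nseq mulnC.
Qed.

Lemma count_type_word a r i k : count a (type_word r i k) =
  \sum_(1 <= j < r.+1) k j * a (i j).-1.
Proof.
by rewrite -sumn_count; apply: (sumn_type_word (fun v => nat_of_bool (a v))).
Qed.

Lemma mem_type_word r i k v :
  (v \in type_word r i k) = has (fun j => (0 < k j) && ((i j).-1 == v)) (index_iota 1 r.+1).
Proof.
apply/flatten_mapP/hasP => -[j jr].
  by rewrite mem_nseq => /andP[kj /eqP->]; exists j; rewrite // kj /=.
by case/andP=> kj /eqP<-; exists j; rewrite // mem_nseq kj /=.
Qed.

Lemma count_mem_type_word r i k j : {in index_iota 1 r.+1 &, injective (predn \o i)} ->
  j \in index_iota 1 r.+1 -> count_mem (i j).-1 (type_word r i k) = k j.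
Proof.
move=> inj jr; rewrite count_type_word (bigD1_seq j) ?iota_uniq //= eqxx muln1.
rewrite big_seq_cond big1 ?addn0 // => l /andP[lr lj].
by rewrite (inj_in_eq inj) // (negPf lj) muln0.
Qed.

(** A block is determined by its head and returns it as entry 0, so counting blocks is counting
    heads. *)
Lemma card_AP_blocks n m (t : n.+1.-tuple 'I_n.+1) v : m < n.+1 -> tiles m (vals t) ->
  #|[set B in AP_blocks m t | size B == v.+1]| = count_mem v (word m (vals t)).
Proof.
move=> mn tm; rewrite count_word //; move/(tilesP _ mn): tm => step.
rewrite -[RHS](@card_in_imset _ _ (fun c => insub_bseq n.+1 (AP_seq m c (tnth t c).+1))).
  apply: eq_card => B; rewrite inE; apply/andP/imsetP.
    case=> /imsetP[c]; rewrite inE => c0 ->.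
    by rewrite val_AP_block // size_mkseq eqSS => cv; exists c; rewrite // inE c0.
  case=> c; rewrite inE => /andP[c0 cv] ->; split; first by apply: imset_f;
    rewrite inE c0.
  by rewrite val_AP_block // size_mkseq eqSS.
move=> c c' _ _ /(congr1 (fun B => nth 0%R (bseqval B) 0)).
by rewrite !val_AP_block // !nth_mkseq // !mulr0n !addr0.
Qed.

(** Multiplicities need only be compared at letters that occur in one of the words; the first clause
    of [has_type] makes each of these some [(i j).-1]. *)
Lemma has_type_blocks n m r i k (t : n.+1.-tuple 'I_n.+1) : m < n.+1 ->
  tiles m (vals t) -> {in index_iota 1 r.+1 &, injective (predn \o i)} ->
  (forall j, j \in index_iota 1 r.+1 -> 0 < i j /\ 0 < k j) ->
  has_type (AP_blocks m t) r i k = perm_eq (word m (vals t)) (type_word r i k).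
Proof.
move=> mn tm inj pos.
have cardE j : j \in index_iota 1 r.+1 ->
    #|[set B in AP_blocks m t | size B == i j]| = count_mem (i j).-1 (word m (vals t)).
  by move=> /pos[ij _]; rewrite -card_AP_blocks // prednK.
have posP B : B \in AP_blocks m t -> 0 < size B.
  have /AP_partitionP[Pb _ _] := AP_partition_blocks mn tm.
  by move=> /Pb/and3P[].
have sizeP B : B \in AP_blocks m t -> (size B).-1 \in word m (vals t).
  move=> BP; rewrite -has_pred1 has_count -card_AP_blocks //; apply/card_gt0P.
  by exists B; rewrite inE BP prednK ?eqxx ?posP.
have lenP v : v \in type_word r i k -> exists2 j,
  j \in index_iota 1 r.+1 & v = (i j).-1.
  by rewrite mem_type_word => /hasP[j jr /andP[_ /eqP<-]]; exists j.
apply/idP/idP => [/andP[/forall_inP Bt /allP kt] | wt].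
  apply/allP => v /=; rewrite mem_cat => vw.
  have [j jr ->] : exists2 j, j \in index_iota 1 r.+1 & v = (i j).-1.
    case/orP: vw => [|/lenP//]; rewrite -has_pred1 has_count -card_AP_blocks //.
    case/card_gt0P=> B; rewrite inE => /andP[/Bt/hasP[j jr /eqP Bj] /eqP vB].
    by exists j; rewrite // -Bj vB.
  by rewrite count_mem_type_word // -(eqP (kt _ jr)) cardE.
apply/andP; split; last by apply/allP => j jr;
  rewrite cardE // (permP wt) count_mem_type_word.
apply/forall_inP => B BP; have := sizeP B BP; rewrite (perm_mem wt) => /lenP[j jr E].
apply/hasP; exists j => //; have [ij _] := pos j jr;
  by rewrite -(prednK ij) -E (prednK (posP B BP)).
Qed.

Lemma card_AP_partitions n m r i k : m < n.+1 ->
  {in index_iota 1 r.+1 &, injective (predn \o i)} ->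
  (forall j, j \in index_iota 1 r.+1 -> 0 < i j /\ 0 < k j) ->
  #|AP_partitions n.+1 m r i k| = #|tilings n.+1 m (type_word r i k)|.
Proof.
move=> mn inj pos; rewrite -(card_in_imset (f := @AP_blocks n m)).
  apply: eq_card => P; rewrite inE; apply/andP/imsetP => [[Pm Pt]|[t]].
    exists (remaining P); rewrite ?blocks_remaining // inE.
    by rewrite AP_partition_tiles -?has_type_blocks ?AP_partition_tiles ?blocks_remaining.
  rewrite inE => /andP[tm tw] ->; split; first exact: AP_partition_blocks.
  by rewrite has_type_blocks.
move=> t t'; rewrite !inE => /andP[tm _] /andP[tm' _] E.
by rewrite -(remaining_blocks mn tm) E remaining_blocks.
Qed.

(** * The ceiling hypothesis and the final count *)

Import Order.TTheory GRing.Theory Num.Theory.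
Local Open Scope ring_scope.

(** An integer [C] is at most the ceiling of x exactly when C - 1 < x; clearing the denominator
    gives the strict bound for the pigeonhole argument. *)
Lemma ceil_ratio_leq (C p q : nat) : (0 < q)%N ->
  C%:Z <= Num.ceil (p%:R / q%:R : rat) -> (C * q < p + q)%N.
Proof.
move=> q0; rewrite -ltzD1 -ltrBlDr.
case: C => [|C]; first by rewrite mul0n addn_gt0 q0 orbT.
rewrite -[C.+1]addn1 PoszD addrK ceil_gt_int ltr_pdivlMr ?ltr0n //.
by rewrite -natrM ltr_nat mulnDl mul1n ltn_add2r.
Qed.

Theorem theorem2 (n m r : nat) (i k : nat -> nat)
  (hn : (1 <= n)%N) (hm : (1 <= m)%N) (hr : (2 <= r)%N)
  (hi1 : i 1%N = 1%N) (hi2 : (1 < i 2%N)%N)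
  (hi : forall j : nat, (2 <= j < r)%N -> (i j < i j.+1)%N)
  (hk : forall j : nat, (1 <= j <= r)%N -> (1 <= k j)%N)
  (hsum : n = (k 1 + \sum_(2 <= j < r.+1) k j * i j)%N)
  (hceil : (m%:Z - 1) * ((i r)%:Z - 1) <=
     Num.ceil ((k 1%N)%:R / (\sum_(2 <= j < r.+1) k j)%:R : rat)) :
  (#|AP_partitions n m r i k|)%:R =
    n%:R / (\sum_(1 <= j < r.+1) k j)%:R * (multinomial r k)%:R :> rat.

Proof.
have idx j : (j \in index_iota 1 r.+1) = (1 <= j <= r)%N by rewrite mem_index_iota.
have r1 : (1 < r.+1)%N by rewrite ltnS ltnW.
have i_lt j l : (1 <= j)%N -> (j < l)%N -> (l <= r)%N -> (i j < i l)%N.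
  move=> j1; elim: l => // l IH; rewrite ltnS leq_eqVlt => /predU1P[<- jr|jl lr].
    by have [->|j2] := eqVneq j 1%N; [rewrite hi1 | apply: hi; lia].
  by apply: ltn_trans (IH jl (ltnW lr)) _; apply: hi; lia.
have i_inj : {in index_iota 1 r.+1 &, injective (predn \o i)}.
  have i_gt0 j : (1 <= j <= r)%N -> (0 < i j)%N.
    by case/andP; case: (ltngtP j 1%N) => // [j1 _ jr|->];
      [apply: leq_ltn_trans (i_lt 1%N j _ _ _) | rewrite hi1].
  move=> j l; rewrite !idx /= => jr lr E.
  have {}E : i j = i l by move: (i_gt0 j jr) (i_gt0 l lr) E; lia.
  case: (ltngtP j l) => // jl; [have := i_lt j l|have := i_lt l j]; lia.
have pos j : j \in index_iota 1 r.+1 -> (0 < i j)%N /\ (0 < k j)%N.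
  rewrite idx => jr; split; last exact: hk.
  by case: (ltngtP j 1%N) jr => // [j1 /andP[_ jr]|-> _]; [have := i_lt 1%N j;
    lia | rewrite hi1].
set K := (\sum_(2 <= j < r.+1) k j)%N in hceil.
set t := (\sum_(1 <= j < r.+1) k j)%N.
have tE : t = (k 1%N + K)%N by rewrite /t big_ltn.
have K0 : (0 < K)%N.
  rewrite /K big_nat_recr //=; have := hk r; lia.
(* Blocks other than singletons have at least two cells, and a longest block leaves room for a
   singleton. *)
have n_ge : (k 1%N + K.*2 <= n)%N /\ (i r < n)%N.
  have ge2 : (K.*2 <= \sum_(2 <= j < r.+1) k j * i j)%N.
    rewrite -muln2 big_distrl /= !big_nat; apply: leq_sum => j jr.
    by rewrite leq_mul2l; have := i_lt 1%N j; rewrite hi1; lia.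
  split; first by rewrite hsum leq_add2l.
  rewrite hsum big_nat_recr //=; have := hk r; have := hk 1%N; nia.
set a := (i r).-1; have a0 : (0 < a)%N by have := i_lt 1%N r; rewrite /a hi1; lia.
have flatK : (a * m.-1 * K < k 1%N + K)%N.
  apply: ceil_ratio_leq => //; apply: le_trans hceil.
  have -> : (m%:Z - 1) = m.-1 by lia.
  have -> : ((i r)%:Z - 1) = a by rewrite /a in a0 *; lia.
  by rewrite -PoszM mulnC.
(* The chain is m <= k_1 + K < k_1 + 2K <= n, from [flatK] and [n_ge]. *)
have mn : (m < n)%N.
  have : (m.-1 <= a * m.-1 * K)%N by rewrite mulnAC leq_pmull // muln_gt0 a0.
  lia.
have an : (a < n)%N by rewrite /a; lia.
case: n => [//|n] in hn hsum n_ge mn an *.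
set w0 := type_word r i k.
have size_w0 : size w0 = t.
  rewrite -count_predT count_type_word; apply: eq_bigr => j _; exact: muln1.
have sum_w0 : n.+1 = sumn (map succn w0).
  rewrite sumn_type_word hsum [RHS]big_ltn // hi1 muln1; congr addn.
  rewrite !big_nat; apply: eq_bigr => j jr.
  have [|ij _] := pos j; last by rewrite prednK.
  by rewrite idx; lia.
have nz_w0 : count (predC1 0%N) w0 = K.
  rewrite count_type_word big_ltn // hi1 muln0 add0n /K !big_nat.
  by apply: eq_bigr => j jr; have := i_lt 1%N j; rewrite hi1 /=; nia.
have w0a : all (leq^~ a) w0.
  apply/allP => v; rewrite mem_type_word => /hasP[j]; rewrite idx => jr /andP[_ /eqP<-].
  by have := i_lt j r; rewrite /a; case: (ltngtP j r) => [||->]; lia.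
(* Only [K] letters are nonzero, so by [flatK] they cannot meet every cyclic window of length
   [a * m.-1]. *)
have flat w : perm_eq w w0 -> exists2 p, (p < size w)%N & ends_flat m a (rot p w).
  move=> ww; apply: exists_flat_rot; rewrite (permP ww) nz_w0 //.
  by rewrite (perm_size ww) size_w0 tE.
have cardE : (#|AP_partitions n.+1 m r i k| * t = n.+1 * size (permutations w0))%N.
  rewrite card_AP_partitions // -size_w0; apply: card_tilings flat => //.
  by rewrite hm ltnW.
have multE : multinomial r k = size (permutations w0).
  (* The distinct letters [(i j).-1] occur [k j] times each, so their factorials form the
     denominator. *)
  rewrite /multinomial -/t -size_w0 -(@prod_fact_permutations _ (map (predn \o i) (index_iota 1 r.+1))).
  - rewrite big_map (_ : (\prod_(j <- _) _)%N = (\prod_(1 <= j < r.+1) (k j)`!)%N).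
      by rewrite mulKn // prodn_gt0 // => j; exact: fact_gt0.
    by rewrite big_seq [RHS]big_seq; apply: eq_bigr => j jr;
      rewrite count_mem_type_word.
  - by rewrite map_inj_in_uniq ?iota_uniq.
  move=> v; rewrite mem_type_word => /hasP[j jr /andP[_ /eqP<-]].
  by apply/mapP; exists j.
have t0 : t%:R != 0 :> rat by rewrite pnatr_eq0 tE; lia.
apply: (mulIf t0); rewrite -natrM cardE natrM multE.
by rewrite mulrAC mulfVK.
Qed.
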